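(* Let $n\ge 1$, let $P\subset\mathbb R^n$ be an $n$-dimensional simple polytope, and let $P$ be covered by a finite family of closed sets $X_1,\ldots,X_N\subseteq P$ with covering multiplicity at most $n$. Then some $X_i$ intersects at least $n+1$ facets of $P$.
   Context: A polytope is the convex hull of finitely many points. An $n$-dimensional polytope is simple if each of its vertices lies in exactly $n$ facets, where a facet is a face of dimension $n-1$. A family $\{X_i\}$ has covering multiplicity at most $m$ if no point belongs to more than $m$ of the sets $X_i$ (sets counted by index). *)

(* Defs.v *)
From HB Require Import structures.
From mathcomp Require Import all_boot all_order all_algebra.
From mathcomp Require Import all_classical all_reals all_analysis.

Set Implicit Arguments.
Unset Strict Implicit.
Unset Printing Implicit Defensive.

Import Order.TTheory GRing.Theory Num.Theory.

Local Open Scope classical_set_scope.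
Local Open Scope ring_scope.
Local Open Scope card_scope.

Section Polytopes.
Variables (R : realType) (m : nat).
Local Notation V := 'rV[R]_m.

Definition convex_hull (A : set V) : set V := smallest (@convex_set R V) A.

Definition affine_hull (A : set V) : set V :=
  [set x | exists (k : nat) (p : 'I_k -> V) (t : 'I_k -> R),
    [/\ forall i, A (p i), \sum_i t i = 1 & x = \sum_i t i *: p i]].

(* The empty set has no dimension [d : nat], whereas the usual convention gives
   it dimension [-1]. *)
Definition has_dim (A : set V) (d : nat) : Prop :=
  exists (x0 : V) (U : {vspace V}),
    affine_hull A = [set x0 + u | u in [set u | u \in U]] /\ \dim U = d.

Definition is_polytope (P : set V) : Prop :=
  exists2 A : set V, finite_set A & P = convex_hull A.

Definition dotprod (u v : V) : R := \sum_i u 0 i * v 0 i.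

(* [c = 0] is allowed, so [P] itself and [set0] are faces of [P]. *)
Definition is_face (P F : set V) : Prop :=
  exists (c : V) (b : R), (forall x, P x -> dotprod c x <= b) /\
    F = [set x | P x /\ dotprod c x = b].

Definition is_vertex (P : set V) (v : V) : Prop := is_face P [set v].

Definition is_facet (P F : set V) : Prop :=
  is_face P F /\ exists d, has_dim P d.+1 /\ has_dim F d.

Definition is_simple_polytope (d : nat) (P : set V) : Prop :=
  [/\ is_polytope P, has_dim P d &
      forall v, is_vertex P v -> [set F | is_facet P F /\ F v] #= `I_d].

End Polytopes.

Definition multiplicity_at_most (T I : Type) (X : I -> set T) (k : nat) : Prop :=
  forall x, [set i | X i x] #<= `I_k.

(* Main.v *)
Require Import Defs.
From mathcomp Require Import all_boot all_order all_algebra.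
From mathcomp Require Import all_fingroup zify ring lra.
From mathcomp Require Import all_classical all_reals all_analysis.

(** Suppose that every [X i] meets at most [n] facets.  Perturb the facet
normals [c j], seen from an interior point of [P], into general position; then
for every [i] some point [p i], possibly outside [P], lies on all the perturbed
hyperplanes of the facets met by [X i].  A partition of unity subordinate to
small neighbourhoods of the [X i] gives a continuous map [f = sum phi_i p_i] of
[P] sending every facet into its perturbed hyperplane.  Such a map covers a
neighbourhood of the interior point: extending it radially to a vector field
that is radial far away, Brouwer's theorem produces a zero, and a zero outside
[P] would contradict the position of the perturbed hyperplanes.  But at most
[n] of the [phi_i] are nonzero at any point, so the image of [f] lies in
finitely many simplices of dimension less than [n], which miss some point near
the interior point.

The form of Brouwer's theorem needed here comes from a Sperner-type lemma.  On
a triangulated torus, which has no boundary, the signed number of fully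
labelled simplices vanishes for every labelling; two labellings that agree on
the simplices wrapping around the torus thus have the same signed count on the
remaining ones. *)

Set Implicit Arguments.
Unset Strict Implicit.
Unset Printing Implicit Defensive.

Import Order.TTheory GRing.Theory Num.Theory.
Import numFieldNormedType.Exports.

Local Open Scope classical_set_scope.
Local Open Scope ring_scope.
Local Open Scope card_scope.

(** * A Sperner lemma from a boundaryless torus *)

Section TorusLabelling.
Variables (T : finZmodType) (n : nat) (e : 'I_n -> T).

(** The vertices of a simplex of Kuhn's triangulation: the path from the corner [z] that takes the
    steps [e] in the order [s]. *)
Definition kuhn_vertex (z : T) (s : 'S_n) (j : nat) : T :=
  z + \sum_(k < n | (k < j)%N) e (s k).

(* The indicator columns of all the labels sum to the all-ones column, so the
   latter may stand for column 0: up to sign this tests bijectivity of [lab],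
   and expanding along it gives the alternating sum over the faces. *)
Definition label_mx (lab : 'I_n.+1 -> 'I_n.+1) : 'M[int]_n.+1 :=
  \matrix_(j, c) if c == 0 then 1 else (lab j == c)%:R.

(** Up to sign, this tests whether the labels of a face are exactly the nonzero ones. *)
Definition label_minor (lab : 'I_n -> 'I_n.+1) : int :=
  \det (\matrix_(j < n, c < n) ((lab j == lift ord0 c)%:R : int)).

Lemma det_label_mx_inj lab : \det (label_mx lab) != 0 -> injective lab.
Proof.
move=> d0 j k jk; apply/eqP; apply: contraNT d0 => njk; apply/eqP.
by apply: (determinant_alternate njk) => c; rewrite !mxE jk.
Qed.

Lemma det_label_mx_id lab : (forall j, lab j = j) -> \det (label_mx lab) = 1.
Proof.
move=> labE; rewrite det_trig.
  by apply: big1 => i _; rewrite mxE labE eqxx; case: ifP.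
apply/is_trig_mxP => i j ij; rewrite mxE labE.
case: eqP => [j0|_]; first by move: ij; rewrite j0.
by rewrite -val_eqE /= ltn_eqF.
Qed.

Lemma det_label_mx_expand lab :
  \det (label_mx lab) =
  \sum_(j < n.+1) (-1) ^+ j * label_minor (fun k => lab (lift j k)).
Proof.
rewrite (expand_det_col _ ord0); apply: eq_bigr => j _.
rewrite mxE eqxx mul1r /cofactor addn0; congr (_ * _).
rewrite /label_minor; congr (\det _); apply/matrixP => a b.
by rewrite !mxE; case: eqP => // /eqP; rewrite eq_sym (negPf (neq_lift _ _)).
Qed.

Lemma eq_label_minor l1 l2 : l1 =1 l2 -> label_minor l1 = label_minor l2.
Proof.
by move=> l12; congr (\det _); apply/matrixP => a b; rewrite !mxE l12.
Qed.

Lemma eq_det_label_mx l1 l2 :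
  l1 =1 l2 -> \det (label_mx l1) = \det (label_mx l2).
Proof.
by move=> l12; congr (\det _); apply/matrixP => a b; rewrite !mxE l12.
Qed.

(** Unless [j = b], the steps numbered [a] and [b] come both before vertex [j] or both after it. *)
Lemma kuhn_vertex_tperm z s (a b : 'I_n) (j : nat) :
  b = a.+1 :> nat -> j != b -> kuhn_vertex z (tperm a b * s) j = kuhn_vertex z s j.
Proof.
move=> ba jb; rewrite /kuhn_vertex; congr (_ + _).
rewrite [RHS](reindex_inj (@perm_inj _ (tperm a b))) /=.
apply: eq_big => [k|k _]; last by rewrite permM.
case: tpermP => [->|->|//]; first by rewrite ba; move: jb; rewrite ba; lia.
by rewrite ba; move: jb; rewrite ba; lia.
Qed.

Definition label_sum (lab : T -> 'I_n.+1) : int :=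
  \sum_(z : T) \sum_(s : 'S_n)
    (-1) ^+ s * \det (label_mx (fun j : 'I_n.+1 => lab (kuhn_vertex z s j))).

Definition face_sum (lab : T -> 'I_n.+1) (j : 'I_n.+1) : int :=
  \sum_(z : T) \sum_(s : 'S_n)
    (-1) ^+ s * label_minor (fun k => lab (kuhn_vertex z s (lift j k))).

Lemma label_sumE lab :
  label_sum lab = \sum_(j < n.+1) (-1) ^+ j * face_sum lab j.
Proof.
rewrite /label_sum.
under eq_bigr => z _ do under eq_bigr => s _ do
  rewrite det_label_mx_expand mulr_sumr.
under eq_bigr => z _ do rewrite exchange_big /=.
rewrite exchange_big /=; apply: eq_bigr => j _; rewrite mulr_sumr.
apply: eq_bigr => z _; rewrite mulr_sumr; apply: eq_bigr => s _.
by rewrite mulrCA.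
Qed.

(* The two simplices sharing an inner face differ by a transposition. *)
Lemma face_sum_mid lab (j : 'I_n.+1) :
  (0 < j < n)%N -> face_sum lab j = 0.
Proof.
case/andP=> j0 jn; apply: big1 => z _.
have jn' : (j.-1 < n)%N by lia.
pose a := Ordinal jn'; pose b := Ordinal jn.
have ba : b = a.+1 :> nat by rewrite /= prednK.
have ab : a != b by rewrite -val_eqE /=; lia.
set S := \sum_ _ _; suff : S = - S by lia.
rewrite {1}/S (reindex_inj (mulgI (tperm a b))) /= -sumrN.
apply: eq_bigr => s _; rewrite odd_permM odd_tperm ab signr_addb mulN1r mulNr.
congr (- (_ * _)); apply: eq_label_minor => k; rewrite kuhn_vertex_tperm //.
by rewrite /= eq_sym neq_bump.
Qed.

End TorusLabelling.

Section TorusStokes.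
Variables (T : finZmodType) (n : nat) (e : 'I_n.+1 -> T).

Definition rot_perm : 'S_n.+1 := lift_perm ord_max ord0 1%g.

Lemma rot_perm_widen (k : 'I_n) : rot_perm (widen_ord (leqnSn n) k) = lift ord0 k.
Proof.
have -> : widen_ord (leqnSn n) k = lift ord_max k.
  by apply: val_inj; rewrite /= /bump leqNgt ltn_ord.
by rewrite lift_perm_lift perm1.
Qed.

(** Starting one step later and postponing the first step to the end gives the same path, shifted by
    one vertex. *)
Lemma kuhn_vertex_rot z (s : 'S_n.+1) (j : nat) : (j <= n)%N ->
  kuhn_vertex e (z + e (s ord0)) (rot_perm * s) j = kuhn_vertex e z s j.+1.
Proof.
move=> jn; rewrite /kuhn_vertex -addrA; congr (_ + _).
rewrite [RHS]big_mkcond big_ord_recl /=; congr (_ + _).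
rewrite big_mkcond big_ord_recr /= ltnNge jn /= addr0.
by apply: eq_bigr => k _; rewrite permM rot_perm_widen /= /bump add1n ltnS.
Qed.

(* The last face of a simplex is the first face of a simplex of the adjacent
   cube, whose permutation is rotated. *)
Lemma face_sum_ends lab :
  face_sum e lab ord0 = (-1) ^+ n * face_sum e lab ord_max.
Proof.
rewrite /face_sum [in RHS]exchange_big [in LHS]exchange_big /= mulr_sumr.
rewrite [RHS](reindex_inj (mulgI rot_perm)) /=; apply: eq_bigr => s _.
rewrite mulr_sumr [RHS](reindex_inj (addIr (e (s ord0)))) /=.
apply: eq_bigr => z _; rewrite mulrA odd_permM signr_addb odd_lift_perm.
rewrite odd_perm1 addbF /= addbF signr_odd mulrA -exprMn mulrNN mulr1 expr1n mul1r.
congr (_ * _); apply: eq_label_minor => k; congr lab.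
rewrite -kuhn_vertex_rot ?leq_ord //=; congr kuhn_vertex.
by rewrite /bump leqNgt ltn_ord.
Qed.

(** Only the first and last faces survive the expansion, and they enter with opposite total
    signs. *)
Lemma label_sum0 lab : label_sum e lab = 0.
Proof.
rewrite label_sumE big_ord_recl big_ord_recr /= mul1r big1 => [|k _].
  rewrite add0r face_sum_ends -mulrDl.
  by rewrite -[bump 0 n]/n.+1 exprS mulN1r addrN mul0r.
by rewrite face_sum_mid ?mulr0 //= ltnS.
Qed.

End TorusStokes.

(* The value is [n] when [p] holds nowhere. *)
Definition first_index (n : nat) (p : pred 'I_n) : 'I_n.+1 :=
  inord (find p (enum 'I_n)).

Lemma val_first_index n (p : pred 'I_n) :
  first_index p = find p (enum 'I_n) :> nat.
Proof.
by rewrite inordK // ltnS (leq_trans (find_size _ _)) // size_enum_ord.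
Qed.

Lemma eq_first_index n (p1 p2 : pred 'I_n) :
  p1 =1 p2 -> first_index p1 = first_index p2.
Proof. by move=> pE; apply: val_inj; rewrite /= !val_first_index (eq_find pE). Qed.

Lemma first_indexP n (p : pred 'I_n) (i : 'I_n) :
  first_index p = i :> nat -> p i.
Proof.
rewrite val_first_index => pE.
have pn : has p (enum 'I_n) by rewrite has_find size_enum_ord pE ltn_ord.
by have := nth_find i pn; rewrite pE nth_ord_enum.
Qed.

Lemma before_first_index n (p : pred 'I_n) (i : 'I_n) :
  (i < first_index p)%N -> ~~ p i.
Proof.
rewrite val_first_index => /(before_find i).
by rewrite nth_ord_enum => ->.
Qed.

Lemma first_index_mono n (p1 p2 : pred 'I_n) :
  (forall i, p2 i -> p1 i) -> (first_index p1 <= first_index p2)%N.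
Proof. by move=> p21; rewrite !val_first_index; apply: sub_find. Qed.

(** * Kuhn's triangulation of a grid closed up to a torus *)

Section Grid.
Variables (n K m : nat).
Local Notation N := n.+1.
Local Notation T := 'rV['I_K.+1]_N.

Definition grid_step (i : 'I_N) : T := \row_k (if k == i then inZp 1 else 0).

Lemma kuhn_vertex_grid (z : T) s j i :
  kuhn_vertex grid_step z s j ord0 i = z ord0 i + inZp ((s^-1%g i < j)%N).
Proof.
rewrite /kuhn_vertex mxE summxE; congr (_ + _).
rewrite big_mkcond (bigD1 (s^-1%g i)) //= mxE permKV eqxx big1 ?addr0.
  by case: ifP => // _; apply: val_inj; rewrite /= mod0n.
move=> k ki; rewrite mxE; case: ifP => // _; case: eqP => // ik.
by move: ki; rewrite ik permK eqxx.
Qed.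

Lemma kuhn_vertex_grid_nat (z : T) s j i : (z ord0 i < K)%N ->
  kuhn_vertex grid_step z s j ord0 i = (z ord0 i + (s^-1%g i < j))%N :> nat.
Proof.
move=> zK; rewrite kuhn_vertex_grid /= modnDmr modn_small //.
by case: (_ < j)%N; lia.
Qed.

(** Hence a simplex that wraps around has all its vertices on the boundary of the grid, where the
    labels are prescribed. *)
Lemma kuhn_vertex_grid_wrap (z : T) s j i : z ord0 i = K :> nat ->
  kuhn_vertex grid_step z s j ord0 i = 0 :> nat \/
  kuhn_vertex grid_step z s j ord0 i = K :> nat.
Proof.
move=> zK; rewrite kuhn_vertex_grid /= modnDmr zK.
by case: (_ < j)%N; [left; rewrite addn1 modnn|right; rewrite addn0 modn_small].
Qed.

(** With the origin placed at [m] in every coordinate, the label is the first negative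
    coordinate. *)
Definition orthant_label (v : T) := first_index (fun i => (v ord0 i < m)%N).

Hypotheses (m_gt0 : (0 < m)%N) (mK : (m <= K)%N).

(** Coordinates only grow along the path, so labels never decrease; being distinct, they must be
    [0, 1, ..., N] in this order. *)
Lemma orthant_label_simplex (z : T) (s : 'S_N) :
  (forall i, z ord0 i < K)%N ->
  injective (fun j : 'I_N.+1 => orthant_label (kuhn_vertex grid_step z s j)) ->
  [/\ forall i, z ord0 i = m.-1 :> nat, s = 1%g &
      forall j : 'I_N.+1, orthant_label (kuhn_vertex grid_step z s j) = j].
Proof.
move=> zK linj.
pose l (j : 'I_N.+1) := orthant_label (kuhn_vertex grid_step z s j).
have lmono (j k : 'I_N.+1) : (j < k)%N -> (l j < l k)%N.
  move=> jk; rewrite ltn_neqAle; apply/andP; split.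
    by rewrite val_eqE; apply: contraTneq jk => /linj ->; rewrite ltnn.
  apply: first_index_mono => i; rewrite !kuhn_vertex_grid_nat //.
  by case: (ltnP _ j) => ij; case: (ltnP _ k) => ik; lia.
have lge (k : nat) (kN : (k < N.+1)%N) : (k <= l (Ordinal kN))%N.
  elim: k kN => // k IHk kN; have kN' : (k < N.+1)%N by lia.
  apply: leq_ltn_trans (IHk kN') _.
  by apply: lmono => /=.
have lle (k : nat) (kN : (N - k < N.+1)%N) : (k <= N)%N ->
    (l (Ordinal kN) <= N - k)%N.
  elim: k kN => [|k IHk] kN k_le; first by move: (ltn_ord (l (Ordinal kN))); lia.
  have kN' : (N - k < N.+1)%N by lia.
  have := IHk kN' (ltnW k_le).
  have := @lmono (Ordinal kN) (Ordinal kN'); rewrite /= => /(_ ltac:(lia)).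
  lia.
have lE (j : 'I_N.+1) : l j = j.
  apply: val_inj; apply/eqP; rewrite eqn_leq.
  have := ltn_ord j; rewrite ltnS => jN.
  have jN' : (N - (N - j) < N.+1)%N by lia.
  have := lle (N - j)%N jN' (leq_subr _ _).
  rewrite (_ : Ordinal jN' = j); last by apply: val_inj; rewrite /= subKn.
  rewrite subKn // => -> /=.
  by have := lge j (ltn_ord j); rewrite (_ : Ordinal _ = j) //; apply: val_inj.
(* Coordinate [i] is below [m] at vertex [i] but not at vertex [i + 1], so the step between them
   raises it from [m - 1] to [m]. *)
have key (i : 'I_N) : s^-1%g i = i /\ z ord0 i = m.-1 :> nat.
  have i1 : (i < N.+1)%N by have := ltn_ord i; lia.
  have i2 : (i.+1 < N.+1)%N by have := ltn_ord i; lia.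
  have := @first_indexP _ _ i (congr1 val (lE (Ordinal i1))).
  have := @before_first_index _ _ i
    (eq_leq (esym (congr1 val (lE (Ordinal i2))))).
  rewrite !kuhn_vertex_grid_nat //=; set a := (_ < i.+1)%N; set b := (_ < i)%N.
  have : a ==> b = (nat_of_ord (s^-1%g i) != i) by rewrite /a /b; lia.
  case: eqP => [si _|_]; last by case: a; case: b => //=; lia.
  rewrite /a /b si ltnn ltnS leqnn => h1 h2; split; first exact: val_inj.
  by lia.
split => //; first by move=> i; have [] := key i.
apply/permP => i; rewrite perm1.
by have [si _] := key i; rewrite -{1}si permKV.
Qed.

(** Vertex [j] has its first [j] coordinates equal to [m] and the others to [m - 1]. *)
Lemma orthant_label_id (j : 'I_N.+1) :
  orthant_label (kuhn_vertex grid_step (const_mx (inord m.-1)) 1 j) = j.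
Proof.
have zE i : (const_mx (inord m.-1) : T) ord0 i = m.-1 :> nat.
  by rewrite mxE inordK // ltnS; lia.
apply: val_inj; rewrite /= val_first_index.
rewrite (eq_find (a2 := fun i : 'I_N => (j <= i)%N)); last first.
  move=> i; rewrite kuhn_vertex_grid_nat ?zE ?invg1 ?perm1; last by lia.
  by case: (ltnP i j) => ij; lia.
have -> : find (fun i : 'I_N => (j <= i)%N) (enum 'I_N) =
          find (fun i : nat => (j <= i)%N) (iota 0 N).
  by rewrite -val_enum_ord find_map.
have := ltn_ord j; move: (nat_of_ord j) => k; rewrite ltnS => kN.
rewrite -(subnKC kN) iotaD find_cat add0n.
have -> : has (fun i => k <= i)%N (iota 0 k) = false.
  by apply/hasPn => i; rewrite mem_iota; lia.
rewrite size_iota; case: (N - k)%N => [|d] /=; first by rewrite addn0.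
by rewrite leqnn addn0.
Qed.

Lemma sperner_grid (lab : T -> 'I_N.+1) :
  (forall v : T, (exists i, v ord0 i = 0 :> nat \/ v ord0 i = K :> nat) ->
     lab v = orthant_label v) ->
  exists (z : T) (w : 'I_N.+1 -> T),
    (forall j i, z ord0 i <= w j ord0 i <= (z ord0 i).+1)%N /\ (forall c, exists j, lab (w j) = c).
Proof.
move=> labE.
pose D (l : T -> 'I_N.+1) z (s : 'S_N) :=
  \det (label_mx (fun j => l (kuhn_vertex grid_step z s j))).
pose inner (z : T) := [forall i, z ord0 i < K]%N.
suff [z [s [zK dn0]]] :
    exists z s, inner z /\ D lab z s != 0.
  exists z, (fun j => kuhn_vertex grid_step z s j); split=> [j i|c].
    rewrite kuhn_vertex_grid_nat; last exact: (forallP zK).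
    by case: (_ < j)%N; lia.
  have [g _ gK] := injF_bij (det_label_mx_inj dn0).
  by exists (g c); rewrite gK.
have [/existsP[z /existsP[s /andP[zK d0]]]|nex] :=
    boolP [exists z, [exists s, inner z && (D lab z s != 0)]].
  by exists z, s.
have D0 z s : inner z -> D lab z s = 0.
  move=> zK; apply/eqP; apply: contraNT nex => d0.
  by apply/existsP; exists z; apply/existsP; exists s; rewrite zK.
have outer z s : ~~ inner z -> D lab z s = D orthant_label z s.
  case/forallPn => i; rewrite -leqNgt => zK; apply: eq_det_label_mx => j.
  apply: labE; exists i; apply: kuhn_vertex_grid_wrap; apply/eqP.
  by rewrite eqn_leq zK -ltnS ltn_ord.
(* With no inner simplex fully labelled by [lab], the two sums differ exactly by the one full
   simplex of [orthant_label]; yet both sums vanish. *)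
have: label_sum grid_step lab - label_sum grid_step orthant_label = - 1.
  rewrite /label_sum -sumrB.
  pose z0 : T := const_mx (inord m.-1).
  have z0E i : z0 ord0 i = m.-1 :> nat by rewrite mxE inordK // ltnS; lia.
  have z0K : inner z0 by apply/forallP => i; rewrite z0E; lia.
  have D1 : D orthant_label z0 1%g = 1.
    by apply: det_label_mx_id => j; apply: orthant_label_id.
  have Dz z s : inner z -> (z, s) != (z0, 1%g) -> D orthant_label z s = 0.
    move=> zK; apply: contraNeq => /det_label_mx_inj.
    move=> /(orthant_label_simplex (forallP zK))[zE -> _].
    apply/eqP; congr (_, _); apply/rowP => i; apply: val_inj.
    exact: etrans (zE i) (esym (z0E i)).
  rewrite (bigD1 z0) //= [X in _ + X]big1 => [|z nz]; last first.
    rewrite -sumrB big1 // => s _; rewrite -mulrBr -/(D lab z s).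
    rewrite -/(D orthant_label z s); have [zK|zK] := boolP (inner z).
      by rewrite D0 ?Dz ?subrr ?mulr0 // xpair_eqE (negPf nz).
    by rewrite outer ?subrr ?mulr0.
  rewrite addr0 -sumrB (bigD1 1%g) //= [X in _ + X]big1 => [|s ns]; last first.
    rewrite -mulrBr -/(D lab z0 s) -/(D orthant_label z0 s).
    by rewrite D0 ?Dz ?subrr ?mulr0 // xpair_eqE (negPf ns) andbF.
  rewrite -/(D lab z0 1%g) -/(D orthant_label z0 1%g) D0 // D1.
  by rewrite odd_perm1 mulr0 mulr1 add0r addr0.
by rewrite !label_sum0.
Qed.

End Grid.

(** * Existence of zeros *)

Section RowVectorNorm.
Variables (R : realType) (n : nat).
Implicit Types (x : 'rV[R]_n) (e : R).

Lemma coord_le_norm x i : `|x ord0 i| <= `|x|.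
Proof.
rewrite [leRHS]/Num.norm /= mx_normrE.
by apply/bigmax_geP; right; exists (ord0, i).
Qed.

Lemma norm_le_coord x e :
  0 <= e -> (forall i, `|x ord0 i| <= e) -> `|x| <= e.
Proof.
move=> e0 xe; rewrite [leLHS]/Num.norm /= mx_normrE.
by apply/bigmax_leP; split=> // -[i j] _ /=; rewrite ord1.
Qed.

Lemma norm_ball_compact e : compact [set x : 'rV[R]_n | `|x| <= e].
Proof.
apply: bounded_closed_compact.
  by exists e; split=> [|M eM x /= xe]; rewrite ?num_real //; exact: le_trans (ltW eM).
apply: (@closed_comp _ _ (fun x : 'rV[R]_n => `|x|) [set y | y <= e]).
  by move=> x _; exact: norm_continuous.
exact: closed_le.
Qed.

End RowVectorNorm.

Section Zero.
Variables (R : realType) (n : nat).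
Local Notation V := 'rV[R]_n.+1.

Lemma locally_signed_coordinate (G : V -> V) (y : V) : continuous G -> G y != 0 ->
  exists2 r : R, 0 < r & exists i,
    (forall w, `|w - y| < r -> 0 < G w ord0 i) \/
    (forall w, `|w - y| < r -> G w ord0 i < 0).
Proof.
move=> Gc /rV0Pn[i Gi].
have ci : {for y, continuous (fun w => G w ord0 i)}.
  exact: continuous_comp (Gc y) (@coord_continuous _ _ _ _ _ _).
move/cvgrPdist_lt: ci => /(_ `|G y ord0 i|); rewrite normr_gt0 => /(_ Gi).
move=> /nbhs_ballP[r /= r0 rG]; exists r => //; exists i.
have H w : `|w - y| < r -> `|G y ord0 i - G w ord0 i| < `|G y ord0 i|.
  by move=> wy; apply: rG; rewrite -ball_normE /= distrC.
have [G0|G0] := ltP 0 (G y ord0 i).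
  left=> w /H; rewrite (gtr0_norm G0) ltr_norml => /andP[_]; lra.
right=> w /H; rewrite (ler0_norm G0) ltr_norml => /andP[+ _]; lra.
Qed.

(* A grid point is labelled by its first negative coordinate of [G], if any; far
   away this is the orthant label, which has exactly one full simplex. *)
Lemma zero_of_radial (G : V -> V) (M : R) : continuous G ->
  (forall y, M < `|y| -> exists2 s : R, 0 < s & G y = s *: y) ->
  exists y, G y = 0.
Proof.
move=> Gc Grad; apply: contrapT => nex.
have Gn0 y : G y != 0 by apply/eqP => Gy; apply: nex; exists y.
have [a Ma] : exists a : nat, M < a%:R.
  exists (Num.bound `|M|).
  exact: le_lt_trans (ler_norm M) (archi_boundP (normr_ge0 M)).
pose P (k : nat) (y : V) := exists i,
    (forall w, `|w - y| <= k.+1%:R^-1 -> 0 < G w ord0 i) \/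
    (forall w, `|w - y| <= k.+1%:R^-1 -> G w ord0 i < 0).
(* Compactness gives a single scale [k] at which, around each point of the ball, some coordinate of
   [G] keeps a strict sign. *)
have := @norm_ball_compact R n.+1 (a.+1%:R).
move=> /compact_near_coveringP /(_ nat \oo P _) [].
  move=> y _; have [r r0 [i Hi]] := locally_signed_coordinate Gc (Gn0 y).
  near=> y' k => /=.
  exists i.
  have yy' : `|y' - y| < r / 2.
    near: y'; apply/nbhs_ballP; exists (r / 2) => /=; first by rewrite divr_gt0.
    by move=> w; rewrite -ball_normE /= distrC.
  have kr : k.+1%:R^-1 < r / 2.
    near: k; exact: near_infty_natSinv_lt (PosNum (divr_gt0 r0 _)).
  have tri w : `|w - y'| <= k.+1%:R^-1 -> `|w - y| < r.
    move=> wy'; have : `|w - y| <= `|w - y'| + `|y' - y|.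
      by rewrite (le_trans _ (ler_normD _ _)) // addrA subrK.
    move/le_lt_trans; apply; rewrite [ltRHS]splitr ltrD //.
    exact: le_lt_trans wy' kr.
  by case: Hi => Hi; [left|right] => w /tri; exact: Hi.
move=> k _ /(_ k (leqnn k)) kP.
pose h : R := k.+1%:R^-1.
have h0 : 0 < h by rewrite invr_gt0.
(* The grid has mesh [h] and fills the cube [|y| <= a + 1], with index [m] at the origin; its
   boundary lies where [G] is radial. *)
pose m := (a.+1 * k.+1)%N.
have mh : m%:R * h = a.+1%:R by rewrite natrM mulfK // pnatr_eq0.
pose pt (v : 'rV['I_(m + m).+1]_n.+1) : V :=
  \row_i (((v ord0 i : nat)%:R - m%:R) * h).
pose lab v := first_index (fun i => G (pt v) ord0 i < 0).
have [||v [i vi]|z [w [zw labw]]] := @sperner_grid n (m + m) m _ _ lab.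
- by rewrite muln_gt0.
- exact: leq_addr.
- have [|s s0 Gs] := Grad (pt v).
    apply: lt_le_trans Ma _; apply: le_trans (coord_le_norm _ i).
    rewrite mxE normrM (gtr0_norm h0).
    have -> : `|(v ord0 i : nat)%:R - m%:R| = m%:R :> R.
      case: vi => ->; first by rewrite sub0r normrN normr_nat.
      by rewrite natrD addrK normr_nat.
    by rewrite mh ler_nat.
  apply: eq_first_index => j; rewrite Gs !mxE pmulr_rlt0 // pmulr_llt0 //.
  by rewrite subr_lt0 ltr_nat.
have [|i Hi] := kP (pt z).
  apply: norm_le_coord => // i; rewrite mxE normrM (gtr0_norm h0) -mh.
  rewrite ler_pM2r // ler_norml; have := ltn_ord (z ord0 i); rewrite ltnS.
  rewrite -(ler_nat R) natrD; have : 0 <= (z ord0 i : nat)%:R :> R by [].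
  by lra.
have near_z j : `|pt (w j) - pt z| <= k.+1%:R^-1.
  apply: norm_le_coord => [|l]; first exact: ltW.
  rewrite !mxE -mulrBl normrM (gtr0_norm h0) -/h ler_piMl ?(ltW h0) //.
  have /andP[] := zw j l; rewrite -!(ler_nat R) -natr1 ler_norml.
  by move=> *; apply/andP; split; lra.
(* Coordinate [i] of [G] is negative at the vertex labelled [i] and nonnegative at the one with the
   last label, so its sign is not constant near [pt z]. *)
have [j1 /(congr1 val) /= lj1] := labw (widen_ord (leqnSn _) i).
have [j2 lj2] := labw ord_max.
have G1 := first_indexP lj1.
have /before_first_index G2 : (i < lab (w j2))%N by rewrite lj2 /=.
case: Hi => Hi.
  by have := Hi _ (near_z j1); move: G1 => /=; lra.
by have := Hi _ (near_z j2); rewrite (negPf G2).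
Unshelve. all: by end_near. Qed.

End Zero.

(** * Maps of polyhedra *)

Section DotProduct.
Variables (R : realType) (n : nat).
Implicit Types (u v w : 'rV[R]_n) (c : R).

Lemma dotprodC u v : dotprod u v = dotprod v u.
Proof. by apply: eq_bigr => i _; rewrite mulrC. Qed.

Lemma dotprodDr u v w : dotprod u (v + w) = dotprod u v + dotprod u w.
Proof.
by rewrite /dotprod -big_split; apply: eq_bigr => i _; rewrite mxE mulrDr.
Qed.

Lemma dotprodZr c u v : dotprod u (c *: v) = c * dotprod u v.
Proof.
by rewrite /dotprod mulr_sumr; apply: eq_bigr => i _; rewrite mxE mulrCA.
Qed.

Lemma dotprodDl u v w : dotprod (u + v) w = dotprod u w + dotprod v w.
Proof. by rewrite dotprodC dotprodDr !(dotprodC w). Qed.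

Lemma dotprodZl c u v : dotprod (c *: u) v = c * dotprod u v.
Proof. by rewrite dotprodC dotprodZr dotprodC. Qed.

Lemma dotprod0r u : dotprod u 0 = 0.
Proof. by rewrite -(scale0r 0) dotprodZr mul0r. Qed.

Lemma dotprod0l u : dotprod 0 u = 0.
Proof. by rewrite dotprodC dotprod0r. Qed.

Lemma dotprodNr u v : dotprod u (- v) = - dotprod u v.
Proof. by rewrite -scaleN1r dotprodZr mulN1r. Qed.

Lemma dotprodBr u v w : dotprod u (v - w) = dotprod u v - dotprod u w.
Proof. by rewrite dotprodDr dotprodNr. Qed.

Lemma dotprodBl u v w : dotprod (u - v) w = dotprod u w - dotprod v w.
Proof. by rewrite dotprodC dotprodBr !(dotprodC w). Qed.

Lemma dotprod_sumr (I : Type) (r : seq I) (P : pred I) (F : I -> 'rV[R]_n) u :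
  dotprod u (\sum_(i <- r | P i) F i) = \sum_(i <- r | P i) dotprod u (F i).
Proof. exact: (big_morph _ (dotprodDr u) (dotprod0r u)). Qed.

Lemma dotprod_ge0 u : 0 <= dotprod u u.
Proof. by apply: sumr_ge0 => i _; rewrite -expr2 sqr_ge0. Qed.

Lemma dotprod_eq0 u : (dotprod u u == 0) = (u == 0).
Proof.
apply/eqP/eqP => [|->]; last exact: dotprod0l.
move/psumr_eq0P => H; apply/rowP => i; rewrite mxE.
by apply/eqP; rewrite -sqrf_eq0 expr2 H // => j _; rewrite -expr2 sqr_ge0.
Qed.

Lemma dotprod_gt0 u : (0 < dotprod u u) = (u != 0).
Proof. by rewrite lt0r dotprod_ge0 dotprod_eq0 andbT. Qed.

Lemma dotprod_continuous u : continuous (fun x => dotprod u x).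
Proof.
apply: continuous_big => [|i _ x]; first exact: add_continuous.
apply: (@continuousM _ _ (fun=> u 0 i) (fun y : 'rV[R]_n => y 0 i)).
  exact: cst_continuous.
exact: coord_continuous.
Qed.

Lemma ler_dotprod_norm u v : `|dotprod u v| <= (\sum_i `|u 0 i|) * `|v|.
Proof.
rewrite mulr_suml; apply: le_trans (ler_norm_sum _ _ _) _.
by apply: ler_sum => i _; rewrite normrM ler_wpM2l // coord_le_norm.
Qed.

End DotProduct.

Section Core.
Variables (R : realType) (n : nat) (I : finType).
Local Notation V := 'rV[R]_n.+1.
Variables (a a' : I -> V) (f : V -> V) (M : R).

Let Q (x : V) := forall i, dotprod (a i) x <= 1.

Hypothesis Q_bounded : forall x, Q x -> `|x| <= M.
Hypothesis f_continuous : continuous f.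
Hypothesis f_facet : forall i x, Q x -> dotprod (a i) x = 1 ->
  0 < dotprod (a' i) x /\ 0 < dotprod (a' i) (f x).

(** The Minkowski gauge of [Q] cut off below at [1], so that dividing [y] by it retracts onto
    [Q]. *)
Let gauge (y : V) : R := \big[Num.max/1]_i dotprod (a i) y.

Let gauge_ge1 y : 1 <= gauge y.
Proof. exact: bigmax_ge_id. Qed.

Let gauge_gt0 y : 0 < gauge y.
Proof. exact: lt_le_trans (gauge_ge1 y). Qed.

Let gauge_continuous : continuous gauge.
Proof.
apply: continuous_big => [|i _]; first exact: max_continuous.
exact: dotprod_continuous.
Qed.

Let Q_retract y : Q ((gauge y)^-1 *: y).
Proof.
move=> i; rewrite dotprodZr mulrC ler_pdivrMr // mul1r.
exact: le_bigmax.
Qed.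

Lemma zero_in_polyhedron : exists2 x, Q x & f x = 0.
Proof.
(* [G] agrees with [f] on the polyhedron and is radial where [gauge y >= 2]. *)
pose G (y : V) : V := Num.max 0 (2 - gauge y) *: f ((gauge y)^-1 *: y) +
  (1 - (gauge y)^-1) *: y.
have Vc : continuous (fun y => (gauge y)^-1).
  by move=> y; exact: continuousV (lt0r_neq0 (gauge_gt0 y)) (@gauge_continuous y).
have c1 : continuous (fun y : V => Num.max 0 (2 - gauge y)).
  move=> y; apply: (@continuous_max _ _ (fun=> 0) (fun y => 2 - gauge y)).
    exact: cst_continuous.
  exact: (continuousB (@cst_continuous _ _ _ y) (@gauge_continuous y)).
have c2 : continuous (fun y : V => f ((gauge y)^-1 *: y)).
  move=> y; apply: (@continuous_comp _ _ _ (fun y : V => (gauge y)^-1 *: y) f);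
    last exact: f_continuous.
  exact: (continuousZ (@Vc y) (@cvg_id _ _)).
have c3 : continuous (fun y : V => 1 - (gauge y)^-1).
  by move=> y; exact: (continuousB (@cst_continuous _ _ _ y) (@Vc y)).
have Gc : continuous G.
  move=> y.
  have := continuousD (continuousZ (@c1 y) (@c2 y)) (continuousZ (@c3 y) (@cvg_id _ (nbhs y))).
  exact.
(* If [gauge y <= 2], then [y / 2] lies in [Q]; hence the radius [2 * M]. *)
have [|y Gy] := @zero_of_radial _ _ G (2 * M) Gc.
  move=> y My; have g2 : 2 < gauge y.
    rewrite ltNge; apply: contraTN My => g2; rewrite -leNgt.
    have : Q (2^-1 *: y).
      move=> i; rewrite dotprodZr mulrC ler_pdivrMr // mul1r.
      by apply: le_trans g2; exact: le_bigmax.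
    by move/Q_bounded; rewrite normrZ gtr0_norm ?invr_gt0 // ler_pdivrMl.
  exists (1 - (gauge y)^-1).
    by rewrite subr_gt0 invf_lt1 // (lt_trans _ g2) // ltr1n.
  by rewrite /G max_l ?scale0r ?add0r // subr_le0 ltW.
have [g1|g1] := eqVneq (gauge y) 1.
  exists y; first by have := Q_retract y; rewrite g1 invr1 scale1r.
  move: Gy; rewrite /G g1 invr1 subrr scale0r addr0 scale1r max_r; last lra.
  by rewrite (_ : 2 - 1 = 1) ?scale1r //; lra.
have {}g1 : 1 < gauge y by rewrite lt_def g1 gauge_ge1.
(* Outside [Q] the retraction of [y] lies on some facet [i], and there [a' i] is nonnegative on the
   first term of [G y] and positive on the second. *)
have [i _ ai] : exists2 i, i \in I & gauge y = dotprod (a i) y.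
  have /bigmax_geP[|[i _ gi]] := lexx (gauge y); first by rewrite leNgt g1.
  by exists i => //; apply/eqP; rewrite eq_le gi le_bigmax.
have ax1 : dotprod (a i) ((gauge y)^-1 *: y) = 1.
  by rewrite dotprodZr -ai mulVf // gt_eqF.
have [a'x a'f] := f_facet (Q_retract y) ax1.
have a'y : 0 < dotprod (a' i) y.
  by move: a'x; rewrite dotprodZr pmulr_rgt0 // invr_gt0.
have /eqP := congr1 (dotprod (a' i)) Gy.
rewrite dotprod0r /G dotprodDr !dotprodZr gt_eqF //.
apply: ltr_wpDl; first by rewrite mulr_ge0 ?(ltW a'f) // le_max lexx.
by rewrite mulr_gt0 // subr_gt0 invf_lt1.
Qed.

End Core.

(** * General position *)

Lemma nonroot_in_sequence (R : idomainType) (p : {poly R}) (u : nat -> R) :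
  p != 0 -> injective u -> exists k, p.[u k] != 0.
Proof.
move=> p0 uinj; pose rs := [seq u k | k <- iota 0 (size p)].
have : ~~ all (root p) rs.
  apply/negP => /(max_poly_roots p0)/(_ _).
  by rewrite map_inj_uniq ?iota_uniq // size_map size_iota ltnn => /(_ isT).
by case/allPn => _ /mapP[k _ ->] ?; exists k.
Qed.

Section GeneralPosition.
Variables (R : realType) (n : nat).
Local Notation V := 'rV[R]_n.

(** Points of the moment curve at distinct parameters: any [n] or fewer of them are linearly
    independent. *)
Definition moment_vector (I : finType) (i : I) : V :=
  \row_k (enum_rank i)%:R ^+ k.

Section Perturbation.
Variables (I : finType) (a : I -> V).

(* The coefficients of [a j * 'X + w j] on the first [#|J|] coordinates, with
   [w] the moment vectors: a Vandermonde matrix at ['X = 0]. *)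
Definition pencil_mx (J : {set I}) : 'M[{poly R}]_#|J| :=
  \matrix_(j, c) match insub (c : nat) : option 'I_n with
    | Some l => (a (enum_val j) 0 l) *: 'X + (moment_vector (enum_val j) 0 l)%:P
    | None => 0 end.

Lemma pencil_mx_neq0 (J : {set I}) : (#|J| <= n)%N -> \det (pencil_mx J) != 0.
Proof.
move=> Jn.
pose t : 'rV[R]_#|J| := \row_j (enum_rank (enum_val j))%:R.
suff : (\det (pencil_mx J)).[0] != 0.
  by apply: contra_neq => ->; rewrite horner0.
rewrite -horner_evalE -det_map_mx.
rewrite (_ : map_mx _ _ = (Vandermonde #|J| t)^T); last first.
  apply/matrixP => j c; rewrite !mxE /=.
  have cn : (c < n)%N by rewrite (leq_trans (ltn_ord c)).
  by rewrite insubT /= horner_evalE !hornerE !mxE.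
rewrite det_tr det_Vandermonde; apply/prodf_neq0 => i _.
apply/prodf_neq0 => j ij; rewrite !mxE subr_eq0 eqr_nat.
by apply: contraTneq ij => /val_inj/enum_rank_inj/enum_val_inj ->; rewrite ltnn.
Qed.

(** A large [u k] avoids the roots of all the determinants. With [e] its inverse,
    [a i + e *: moment_vector i] is [e] times the pencil at [u k], so the systems are solvable. *)
Lemma general_position_perturbation (e0 : R) : 0 < e0 ->
  exists2 e : R, 0 < e < e0 & forall J : {set I}, (#|J| <= n)%N ->
    exists p : V, forall i, i \in J ->
      dotprod (a i + e *: moment_vector i) p = 1.
Proof.
move=> e0_gt0.
pose q := \prod_(J : {set I} | (#|J| <= n)%N) \det (pencil_mx J).
have q0 : q != 0 by apply/prodf_neq0 => J; exact: pencil_mx_neq0.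
pose u (k : nat) : R := e0^-1 * k.+2%:R.
have uinj : injective u.
  move=> k l /mulfI; rewrite invr_eq0 gt_eqF // => /(_ isT)/eqP.
  by rewrite eqr_nat => /eqP[].
have [k qk] := nonroot_in_sequence q0 uinj.
have uk : e0^-1 < u k by rewrite /u ltr_pMr ?invr_gt0 // ltr1n.
have uk0 : 0 < u k by apply: lt_trans uk; rewrite invr_gt0.
exists (u k)^-1; first by rewrite invr_gt0 uk0 invf_plt.
move=> J Jn.
pose B := map_mx (horner_eval (u k)) (pencil_mx J).
have Bu : B \in unitmx.
  rewrite unitmxE unitfE.
  have -> : \det B = (\det (pencil_mx J)).[u k].
    by rewrite -horner_evalE -det_map_mx.
  by move: qk; rewrite horner_prod => /prodf_neq0; apply.
pose p0 := invmx B *m const_mx 1 : 'cV[R]_#|J|.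
(* The factor [u k] compensates the [e] in front of the pencil; the coordinates past [#|J|] are
   zero. *)
pose p : V := \sum_c (u k * p0 c 0) *: delta_mx 0 (widen_ord Jn c).
exists p => i iJ; rewrite dotprod_sumr.
have := congr1 (fun M : 'cV[R]_#|J| => M (enum_rank_in iJ i) 0) (mulKVmx Bu (const_mx 1)).
rewrite !mxE => <-; apply: eq_bigr => c _; rewrite dotprodZr.
rewrite /dotprod (bigD1 (widen_ord Jn c)) //= big1 => [|l lc]; last first.
  by rewrite !mxE /= (negPf lc) mulr0.
rewrite !mxE !eqxx /= mulr1 addr0.
have cn : (c < n)%N by rewrite (leq_trans (ltn_ord c)).
rewrite insubT /= horner_evalE hornerD hornerZ hornerX hornerC enum_rankK_in //.
rewrite (_ : (Sub (c : nat) cn : 'I_n) = widen_ord Jn c); last exact: val_inj.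
by rewrite !mxE; field; rewrite gt_eqF.
Qed.

End Perturbation.

(* A hyperplane meets the moment curve in finitely many points. *)
Lemma generic_point (K : finType) (p : K -> V) (e : R) : 0 < e ->
  exists2 q : V, `|q| <= e & forall (J : {set K}) (t : K -> R),
    (#|J| <= n)%N -> \sum_(i in J) t i = 1 -> q <> \sum_(i in J) t i *: p i.
Proof.
move=> e0.
(* A nonzero affine function, with coefficients [v], that vanishes at the points of [J]: at most [n]
   conditions on [n + 1] coefficients. *)
have exv (J : {set K}) : exists v : 'rV[R]_(1 + n), (#|J| <= n)%N ->
    v != 0 /\ forall i, i \in J -> dotprod v (row_mx 1%:M (p i)) = 0.
  have [Jn|_] := leqP #|J| n; last by exists 0.
  pose A : 'M[R]_(#|J|, 1 + n) := \matrix_j row_mx 1%:M (p (enum_val j)).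
  have : kermx A^T != 0.
    rewrite kermx_eq0 /row_free neq_ltn; apply/orP; left.
    by apply: leq_ltn_trans (rank_leq_col _) _; rewrite add1n ltnS.
  case/rowV0Pn => v /sub_kermxP vA v0; exists v => _; split=> // i iJ.
  have := congr1 (fun M : 'rV[R]_#|J| => M 0 (enum_rank_in iJ i)) vA.
  rewrite !mxE => <-; apply: eq_bigr => c _.
  by rewrite !mxE enum_rankK_in.
have [v vP] := choice exv.
(* The affine function [v J] restricted to the curve [(x, x^2, ..., x^n)]. *)
pose r (J : {set K}) : {poly R} := \poly_(i < n.+1) v J 0 (inord i).
pose q := \prod_(J : {set K} | (#|J| <= n)%N) r J.
have q0 : q != 0.
  apply/prodf_neq0 => J /vP[/rV0Pn[c vc] _]; apply: contraNneq vc => rJ.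
  have := congr1 (fun s : {poly R} => s`_c) rJ.
  by rewrite coef_poly ltn_ord coef0 inord_val => ->.
pose d := Num.min e 1.
have d0 : 0 < d by rewrite lt_min e0 ltr01.
pose u (k : nat) : R := d / k.+1%:R.
have uinj : injective u.
  move=> k l /mulfI; rewrite gt_eqF // => /(_ isT)/invr_inj/eqP.
  by rewrite eqr_nat => /eqP[].
have [k qk] := nonroot_in_sequence q0 uinj.
have uk0 : 0 < u k by rewrite divr_gt0.
have ukd : u k <= d by rewrite ler_pdivrMr // ler_peMr ?ler1n // ltW.
exists (\row_i (u k) ^+ i.+1).
  apply: norm_le_coord => [|i]; first exact: ltW.
  rewrite mxE ger0_norm ?exprn_ge0 ?(ltW uk0) //.
  apply: (@le_trans _ _ (u k)); last by rewrite (le_trans ukd) // ge_min lexx.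
  rewrite exprS ler_piMr ?(ltW uk0) // exprn_ile1 ?(ltW uk0) //.
  by rewrite (le_trans ukd) // ge_min lexx orbT.
move=> J t Jn t1 qE; move: qk; rewrite horner_prod => /prodf_neq0/(_ J Jn).
have [_ vJ] := vP J Jn.
suff -> : (r J).[u k] = dotprod (v J) (row_mx 1%:M (\row_i (u k) ^+ i.+1)).
  rewrite qE (_ : row_mx _ _ = \sum_(i in J) t i *: row_mx 1%:M (p i)).
    by rewrite dotprod_sumr big1 ?eqxx // => i iJ; rewrite dotprodZr vJ ?mulr0.
  apply/rowP => c; rewrite summxE.
  case: (split_ordP c) => l ->.
    rewrite row_mxEl ord1 mxE eqxx -[LHS]t1; apply: eq_bigr => i _.
    by rewrite mxE row_mxEl mxE eqxx [RHS]mulr1.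
  rewrite row_mxEr summxE; apply: eq_bigr => i _.
  by rewrite mxE [RHS]mxE row_mxEr.
rewrite horner_poly; apply: eq_bigr => c _; rewrite inord_val; congr (_ * _).
case: (@split_ordP 1 n c) => l ->.
  by rewrite row_mxEl ord1 mxE eqxx expr0.
by rewrite row_mxEr mxE.
Qed.

End GeneralPosition.

(** * Facets of polytopes *)

Lemma dotprod_subZ_sq (R : realType) n (u d : 'rV[R]_n) (s : R) :
  dotprod (u - s *: d) (u - s *: d) =
  dotprod u u - 2 * (s * dotprod u d) + s * (s * dotprod d d).
Proof.
rewrite !(dotprodBl, dotprodBr, dotprodZl, dotprodZr) (dotprodC d u); ring.
Qed.

(** * Convex hulls of finite families and nearest points *)

Section ConvexHull.
Variables (R : realType) (n N : nat) (a : 'I_N -> 'rV[R]_n).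
Local Notation V := 'rV[R]_n.

Definition convex_weights : set 'rV[R]_N :=
  [set t | (forall k, t 0 k \in `[0, 1]) /\ \sum_k t 0 k = 1].

Definition barycenter (t : 'rV[R]_N) : V := \sum_k t 0 k *: a k.

Lemma convex_weights_ge0 t k : convex_weights t -> 0 <= t 0 k.
Proof. by case=> /(_ k); rewrite in_itv /= => /andP[]. Qed.

Lemma convex_weightsI (t : 'rV[R]_N) :
  (forall k, 0 <= t 0 k) -> \sum_k t 0 k = 1 -> convex_weights t.
Proof.
move=> t0 t1; split=> // k; rewrite in_itv /= t0 /= -t1 (bigD1 k) //= lerDl.
by rewrite sumr_ge0.
Qed.

Lemma convex_weights_delta k : convex_weights (delta_mx 0 k).
Proof.
apply: convex_weightsI => [l|]; first by rewrite mxE ler0n.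
rewrite (bigD1 k) //= big1 => [|l lk]; first by rewrite mxE !eqxx addr0.
by rewrite mxE eqxx (negPf lk).
Qed.

Lemma barycenter_delta k : barycenter (delta_mx 0 k) = a k.
Proof.
rewrite /barycenter (bigD1 k) //= big1 => [|l lk].
  by rewrite mxE !eqxx scale1r addr0.
by rewrite mxE eqxx (negPf lk) scale0r.
Qed.

Lemma convex_weights_conv (t s : 'rV[R]_N) (l : R) : 0 <= l <= 1 ->
  convex_weights t -> convex_weights s -> convex_weights (l *: t + (1 - l) *: s).
Proof.
case/andP=> l0 l1 tw sw; apply: convex_weightsI => [k|].
  by rewrite !mxE addr_ge0 // mulr_ge0 ?subr_ge0 // convex_weights_ge0.
under eq_bigr do rewrite !mxE.
by rewrite big_split /= -!mulr_sumr tw.2 sw.2 !mulr1 addrC subrK.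
Qed.

Lemma barycenter_conv (t s : 'rV[R]_N) (l : R) :
  barycenter (l *: t + (1 - l) *: s) =
  l *: barycenter t + (1 - l) *: barycenter s.
Proof.
rewrite /barycenter !scaler_sumr -big_split /=; apply: eq_bigr => k _.
by rewrite !mxE [LHS]scalerDl !scalerA.
Qed.

Lemma convex_hull_family :
  convex_hull (range a) = [set barycenter t | t in convex_weights].
Proof.
apply/seteqP; split.
  apply: smallest_sub.
    move=> x y l /set_mem[t tw <-] /set_mem[s sw <-]; apply/mem_set.
    exists (l%:num *: t + (1 - l%:num) *: s); last exact: barycenter_conv.
    by apply: convex_weights_conv => //; rewrite ge0 le1.
  move=> _ [k _ <-]; exists (delta_mx 0 k).
    exact: convex_weights_delta.
  exact: barycenter_delta.
move=> _ [t tw <-] S [Sconv aS].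
have tge k := convex_weights_ge0 k tw.
(* Partial sums are renormalised to total weight [1], so that each new generator enters by one
   binary convex combination. *)
have key (s : seq 'I_N) : let T := \sum_(k <- s) t 0 k in
    0 < T -> S (T^-1 *: \sum_(k <- s) t 0 k *: a k).
  elim: s => [|k s IHs] /=; first by rewrite big_nil ltxx.
  rewrite !big_cons; set T := \sum_(j <- s) _ in IHs *.
  set y := \sum_(j <- s) _ in IHs *; move=> T0.
  have Tge : 0 <= T by rewrite sumr_ge0.
  have Sa : S (a k) by apply: aS; exists k.
  have [Te|Tn] := eqVneq T 0.
    have -> : y = 0.
      apply: big1_seq => j /andP[_ js].
      move/eqP: Te; rewrite psumr_eq0 // => /allP/(_ j js)/eqP ->.
      by rewrite scale0r.
    rewrite Te !addr0 scalerA mulVf ?scale1r //.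
    by move: T0; rewrite Te addr0 => /lt0r_neq0.
  have Tgt : 0 < T by rewrite lt_def Tn.
  pose l := t 0 k / (t 0 k + T).
  have l0 : 0 <= l by rewrite divr_ge0 // ltW.
  have l1 : l <= 1 by rewrite ler_pdivrMr // mul1r lerDl.
  have /set_mem := Sconv (a k) (T^-1 *: y) (Itv01 l0 l1) (mem_set Sa)
    (mem_set (IHs Tgt)).
  congr S; rewrite /conv /= scalerDr !scalerA; congr (_ *: _ + _ *: _).
    by rewrite mulrC.
  by rewrite /unstable.onem /l; field; rewrite Tn gt_eqF.
by have := key (index_enum _); rewrite /= tw.2 invr1 scale1r; exact.
Qed.

Lemma barycenter_norm t :
  convex_weights t -> `|barycenter t| <= \sum_k `|a k|.
Proof.
case=> t01 _; apply: le_trans (ler_norm_sum _ _ _) _; apply: ler_sum => k _.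
have := t01 k; rewrite in_itv /= => /andP[tk0 tk1].
by rewrite normrZ ger0_norm // ler_piMl.
Qed.

Lemma convex_weights_compact : compact convex_weights.
Proof.
have -> : convex_weights = [set t : 'rV[R]_N | forall k, t ord0 k \in `[0, 1]] `&`
    (fun t : 'rV[R]_N => \sum_k t ord0 k) @^-1` [set 1] by [].
apply: compact_closedI.
  apply: (@rV_compact _ _ (fun=> `[(0 : R), 1]%classic)) => _.
  exact: segment_compact.
apply: closed_comp; last exact: closed_eq.
move=> t _; apply: continuous_big => [|i _]; first exact: add_continuous.
exact: coord_continuous.
Qed.

(** At weights minimising the Euclidean distance to [x], no generator lies in a direction of
    descent. *)
Lemma nearest_point (x : V) : (0 < N)%N ->
  exists2 t, convex_weights t &
    forall k, dotprod (x - barycenter t) (a k - barycenter t) <= 0.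
Proof.
move=> N0; pose dist2 t := dotprod (x - barycenter t) (x - barycenter t).
have bc : continuous barycenter.
  apply: continuous_big => [|i _]; first exact: add_continuous.
  move=> t; apply: continuousZ; first exact: coord_continuous.
  exact: cst_continuous.
have dc : continuous dist2.
  apply: continuous_big => [|i _]; first exact: add_continuous.
  have ci : continuous (fun t => (x - barycenter t) 0 i).
    move=> t; apply: (@continuous_comp _ _ _ (fun t => x - barycenter t)
      (fun y : V => y 0 i)); last exact: coord_continuous.
    exact: (continuousB (@cst_continuous _ _ _ t) (@bc t)).
  by move=> t; exact: (continuousM (@ci t) (@ci t)).
have [|t /set_mem tw tmin] := EVT_min_rV _ convex_weights_compact
    (continuous_subspaceT dc).
  by exists (delta_mx 0 (Ordinal N0)); exact: convex_weights_delta.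
exists t => // k; set u := x - barycenter t; set d := a k - barycenter t.
rewrite leNgt; apply/negP => ud.
have d0 : 0 < dotprod d d.
  by rewrite dotprod_gt0; apply: contraTneq ud => ->; rewrite dotprod0r ltxx.
(* The minimiser on [[0, 1]] of the squared length of [u - s *: d]. *)
pose s := Num.min 1 (dotprod u d / dotprod d d).
have s0 : 0 < s by rewrite lt_min ltr01 divr_gt0.
have s01 : 0 <= s <= 1 by rewrite ltW //= ge_min lexx.
have := tmin _ (mem_set (convex_weights_conv s01 (convex_weights_delta k) tw)).
rewrite /dist2 barycenter_conv barycenter_delta.
rewrite (_ : x - (_ + _) = u - s *: d); last first.
  by apply/rowP => i; rewrite /u /d !mxE; ring.
rewrite -/u dotprod_subZ_sq.
have sd : s * dotprod d d <= dotprod u d by rewrite -ler_pdivlMr // ge_min lexx orbT.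
have : s * (s * dotprod d d) <= s * dotprod u d by rewrite ler_pM2l.
have : 0 < s * dotprod u d by rewrite mulr_gt0.
lra.
Qed.

End ConvexHull.

(** * Vertices of the polar body *)

Section PolarVertices.
Variables (R : realType) (n N : nat) (b : 'I_N -> 'rV[R]_n).
Local Notation V := 'rV[R]_n.

Definition polar (c : V) := forall k, dotprod c (b k) <= 1.

Definition tight (c : V) : {set 'I_N} := [set k | dotprod c (b k) == 1]%SET.

(** Spanning is expressed by orthogonality. Points of the polar body with a spanning [tight] set are
    its vertices, which serve as facet normals of the hull. *)
Definition spanning (J : {set 'I_N}) :=
  forall u : V, (forall k, k \in J -> dotprod u (b k) = 0) -> u = 0.

Hypothesis zero_interior : forall u : V, u != 0 -> exists k, 0 < dotprod u (b k).

(* Move [c] along a direction orthogonal to the tight generators until another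
   generator becomes tight. *)
Lemma raise_tight (c x : V) : polar c -> ~ spanning (tight c) ->
  exists c', [/\ polar c', dotprod c x <= dotprod c' x & tight c \proper tight c'].
Proof.
move=> cP nspan.
have [u [u0 uT ux]] : exists u, [/\ u != 0,
    forall k, k \in tight c -> dotprod u (b k) = 0 & 0 <= dotprod u x].
  have [u /not_implyP[uT /eqP u0]] : exists u, ~ ((forall k, k \in tight c ->
      dotprod u (b k) = 0) -> u = 0) by apply/existsNP.
  have [ux|ux] := leP 0 (dotprod u x); first by exists u.
  exists (- u); rewrite oppr_eq0; split=> // [k kT|].
    by rewrite dotprodC dotprodNr dotprodC uT ?oppr0.
  by rewrite dotprodC dotprodNr dotprodC oppr_ge0 ltW.
have [k0 k0u] := zero_interior u0.
pose r k := (1 - dotprod c (b k)) / dotprod u (b k).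
case: (@arg_minP _ R _ k0 (fun k => 0 < dotprod u (b k)) r k0u) => k uk kmin.
have r0 : 0 <= r k by rewrite divr_ge0 ?subr_ge0 ?cP // ltW.
have c'E l : dotprod (c + r k *: u) (b l) = dotprod c (b l) + r k * dotprod u (b l).
  by rewrite dotprodDl dotprodZl.
exists (c + r k *: u); split.
- move=> l; rewrite c'E; have [ul|ul] := ltP 0 (dotprod u (b l)).
    by rewrite addrC -lerBrDr -ler_pdivlMr // kmin.
  by rewrite -[leRHS]addr0 lerD ?cP // mulr_ge0_le0.
- by rewrite dotprodDl dotprodZl lerDl mulr_ge0.
- apply/properP; split.
    by apply/fintype.subsetP => l lT; rewrite inE c'E uT // mulr0 addr0; move: lT; rewrite inE.
  exists k; rewrite ?inE; last by apply: contraTN uk => kT; rewrite uT ?ltxx // inE.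
  by rewrite c'E /r divfK ?(gt_eqF uk) // addrC subrK.
Qed.

(** Each use of [raise_tight] enlarges the tight set, so at most [N] uses reach a vertex. *)
Lemma polar_vertex_above (c x : V) : polar c ->
  exists c', [/\ polar c', spanning (tight c') & dotprod c x <= dotprod c' x].
Proof.
have [m] := ubnP (N - #|tight c|); elim: m c => // m IHm c cm cP.
have [|nspan] := pselect (spanning (tight c)); first by exists c.
have [c1 [c1P c1x /proper_card cc1]] := raise_tight x cP nspan.
have c1N : (#|tight c1| <= N)%N by rewrite -[leqRHS]card_ord max_card.
have [|c' [c'P c's c'x]] := IHm c1 _ c1P; first by lia.
by exists c'; split=> //; exact: le_trans c'x.
Qed.

Lemma spanning_combination (J : {set 'I_N}) (y : V) : spanning J ->
  exists t : 'I_N -> R, y = \sum_(k in J) t k *: b k.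
Proof.
move=> Jspan.
pose B : 'M[R]_(N, n) := \matrix_k (if k \in J then b k else 0).
have : row_full B.
  rewrite /row_full -mxrank_tr -[_ == _]/(row_free B^T) -kermx_eq0; apply/eqP/row_matrixP => i; rewrite row0.
  apply: Jspan => k kJ.
  have /rowP/(_ k) := congr1 (row i) (mulmx_ker B^T).
  rewrite row_mul row0 mxE [RHS]mxE => kB; rewrite -[RHS]kB /dotprod.
  by apply: eq_bigr => j _; rewrite !mxE kJ.
move=> /(submx_full y) /submxP[D yE]; exists (fun k => D 0 k).
rewrite yE mulmx_sum_row [RHS]big_mkcond /=; apply: eq_bigr => k _.
by rewrite rowK; case: ifP => // _; rewrite scaler0.
Qed.

End PolarVertices.

Section HyperplaneDim.
Variables (R : realType) (n : nat).

Lemma dim_orthogonal (c : 'rV[R]_n) : c != 0 ->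
  exists U : {vspace 'rV[R]_n}, \dim U = n.-1 /\
    forall u, (u \in U) = (dotprod c u == 0).
Proof.
move=> c0; pose g := linfun (mulmxr c^T : 'rV[R]_n -> 'rV[R]_1).
have gE u : g u = (dotprod c u)%:M.
  rewrite lfunE /=; apply/matrixP => i j; rewrite !ord1 mxE [RHS]mxE eqxx.
  by rewrite dotprodC; apply: eq_bigr => k _; rewrite mxE.
exists (lker g); split; last first.
  move=> u; rewrite memv_ker gE -scalemx1 scaler_eq0.
  by rewrite (negPf (matrix_nonzero1 _ _)) orbF.
have := limg_ker_dim g fullv; rewrite capfv dimvf /dim /= mul1n.
suff -> : \dim (g @: fullv) = 1%N by move/(congr1 predn); rewrite addn1.
apply/eqP; rewrite eqn_leq; apply/andP; split.
  by apply: leq_trans (dimvS (subvf _)) _; rewrite dimvf /dim /= mul1n.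
rewrite lt0n dimv_eq0; apply: contraNneq c0 => g0.
have : g c \in (g @: fullv)%VS by rewrite memv_img ?memvf.
rewrite g0 memv0 gE -scalemx1 scaler_eq0.
by rewrite (negPf (matrix_nonzero1 _ _)) orbF dotprod_eq0.
Qed.

End HyperplaneDim.

(** * Facet description of a full-dimensional polytope *)

Section Polytope.
Variables (R : realType) (n : nat).
Local Notation V := 'rV[R]_n.+1.

Lemma affine_hull_full (P : set V) : has_dim P n.+1 -> affine_hull P = setT.
Proof.
move=> [x0 [U [-> dimU]]].
have -> : U = fullv by apply/eqP; rewrite eqEdim subvf dimU dimvf /dim /= mul1n.
apply/seteqP; split=> // x _; exists (x - x0); first exact: memvf.
by rewrite addrCA subrr addr0.
Qed.

Section Family.
Variables (N : nat) (a : 'I_N -> V).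
Let P := [set barycenter a t | t in convex_weights (N := N)].
Hypothesis P_full : affine_hull P = setT.

Definition centroid : V := N%:R^-1 *: \sum_k a k.

Lemma full_family_gt0 : (0 < N)%N.
Proof.
have : affine_hull P 0 by rewrite P_full.
case=> [[|k] [p [t [pP t1 _]]]].
  by move: t1; rewrite big_ord0 => /esym/eqP; rewrite oner_eq0.
have [s [_ s1] _] := pP ord0; rewrite lt0n; apply/eqP => N0.
move: s1; rewrite big1 => [/esym/eqP|[i iN] _]; first by rewrite oner_eq0.
by exfalso; move: iN; rewrite N0.
Qed.

Lemma centroid_in_hull : P centroid.
Proof.
exists (const_mx N%:R^-1).
  apply: convex_weightsI => [k|]; first by rewrite mxE invr_ge0 ler0n.
  under eq_bigr do rewrite mxE.
  rewrite sumr_const card_ord -(mulr_natr N%:R^-1) mulVf // pnatr_eq0 -lt0n.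
  exact: full_family_gt0.
rewrite /barycenter /centroid scaler_sumr.
by apply: eq_bigr => k _; rewrite mxE.
Qed.

Lemma dotprod_barycenter u t : convex_weights t ->
  dotprod u (barycenter a t - centroid) =
  \sum_k t 0 k * dotprod u (a k - centroid).
Proof.
case=> _ t1; rewrite dotprodBr dotprod_sumr.
rewrite -[dotprod u centroid]mul1r -t1 mulr_suml -sumrB.
by apply: eq_bigr => k _; rewrite dotprodZr dotprodBr mulrBr.
Qed.

(** The numbers [dotprod u (a k - centroid)] sum to zero. If none were positive, all would vanish
    and [P] would lie in a hyperplane. *)
Lemma centroid_interior (u : V) : u != 0 -> exists k, 0 < dotprod u (a k - centroid).
Proof.
move=> u0; apply: contrapT => /forallNP uk.
have ule k : dotprod u (a k - centroid) <= 0 by rewrite leNgt; apply/negP.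
have usum : \sum_k dotprod u (a k - centroid) = 0.
  rewrite -dotprod_sumr sumrB sumr_const card_ord /centroid.
  rewrite -scaler_nat scalerA mulfV ?scale1r ?subrr ?dotprod0r //.
  by rewrite pnatr_eq0 -lt0n full_family_gt0.
have ueq k : dotprod u (a k - centroid) = 0.
  apply/eqP; rewrite -oppr_eq0; apply/eqP.
  have /psumr_eq0P : \sum_k - dotprod u (a k - centroid) = 0.
    by rewrite sumrN usum oppr0.
  by apply=> // l _; rewrite oppr_ge0.
have uP x : P x -> dotprod u x = dotprod u centroid.
  move=> [t tw <-]; apply/eqP; rewrite -subr_eq0 -dotprodBr.
  by rewrite dotprod_barycenter // big1 // => k _; rewrite ueq mulr0.
have uV x : dotprod u x = dotprod u centroid.
  have : affine_hull P x by rewrite P_full.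
  case=> [k [p [t [pP t1 ->]]]]; rewrite dotprod_sumr.
  rewrite -[RHS]mul1r -t1 mulr_suml; apply: eq_bigr => i _.
  by rewrite dotprodZr uP.
by move/eqP: u0; apply; apply/eqP; rewrite -dotprod_eq0 uV -(uV 0) dotprod0r.
Qed.

Let b k := a k - centroid.

(** The vector [u] from the nearest point [p] to [x] separates; [B > 0] because the centroid is
    interior, so [u] can be scaled to the bound [1]. *)
Lemma separation (x : V) : ~ P x ->
  exists2 c, polar b c & 1 < dotprod c (x - centroid).
Proof.
move=> nPx.
have [t tw tP] := nearest_point a x full_family_gt0.
set p := barycenter a t in tP; set u := x - p in tP.
have u0 : u != 0.
  by rewrite subr_eq0; apply: contra_notN nPx => /eqP ->; exists t.
pose B := dotprod u (p - centroid).
have split_p y : dotprod u (y - centroid) = dotprod u (y - p) + B.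
  by rewrite -dotprodDr addrA subrK.
have B0 : 0 < B.
  have [k] := centroid_interior u0; rewrite split_p => /lt_le_trans; apply.
  by rewrite gerDr tP.
exists (B^-1 *: u) => [k|]; rewrite dotprodZl.
  by rewrite ler_pdivrMl // mulr1 split_p gerDr tP.
by rewrite ltr_pdivlMl // mulr1 split_p ltrDr dotprod_gt0.
Qed.

Definition is_polar_vertex (J : {set 'I_N}) (c : V) :=
  [/\ polar b c, tight b c = J & spanning b J].

(* Facets are indexed by the sets of generators lying on them. *)
Definition facet_index := {J : {set 'I_N} | `[< exists c, is_polar_vertex J c >]}.

Lemma facet_normal_ex (i : facet_index) : exists c, is_polar_vertex (val i) c.
Proof. exact/asboolP/(valP i). Qed.

Definition facet_normal i := projT1 (cid (facet_normal_ex i)).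

Lemma facet_normalP i : is_polar_vertex (val i) (facet_normal i).
Proof. exact: projT2 (cid (facet_normal_ex i)). Qed.

(** A polar point separating [x] from [P] can be moved to a vertex of the polar body without
    lowering its value at [x]. *)
Lemma facet_halfspaces (x : V) :
  P x <-> forall i, dotprod (facet_normal i) (x - centroid) <= 1.
Proof.
split=> [[t tw <-] i|xle].
  have [cP _ _] := facet_normalP i; rewrite dotprod_barycenter // -tw.2.
  by apply: ler_sum => k _; rewrite ler_piMr ?cP // convex_weights_ge0.
apply: contrapT => /separation[c cP cx].
have [c' [c'P c's cc']] := polar_vertex_above centroid_interior (x - centroid) cP.
have c'V : is_polar_vertex (tight b c') c' by [].
have iP : `[< exists c, is_polar_vertex (tight b c') c >] by apply/asboolP; exists c'.
pose i : facet_index := exist _ (tight b c') iP.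
have [_ dT _] := facet_normalP i; have := xle i.
set d := facet_normal _ in dT *.
(* Both normals take the value [1] on the same spanning set of generators. *)
suff -> : d = c' by move/(lt_le_trans (lt_le_trans cx cc')); rewrite ltxx.
apply/eqP; rewrite -subr_eq0; apply/eqP/c's => k kT.
rewrite dotprodBl; move: (kT); rewrite inE => /eqP ->.
by move: kT; rewrite -[tight b c']/(val i) -dT inE => /eqP ->; rewrite subrr.
Qed.

Definition facet_set i := [set x | P x /\ dotprod (facet_normal i) (x - centroid) = 1].

Lemma generator_in_hull k : P (a k).
Proof.
by exists (delta_mx 0 k); [exact: convex_weights_delta|exact: barycenter_delta].
Qed.

Lemma facet_set_vertex i k : facet_set i (a k) <-> k \in val i.
Proof.
have [_ <- _] := facet_normalP i; rewrite inE; split=> [[_ /eqP//]|/eqP ck].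
by split; first exact: generator_in_hull.
Qed.

Lemma facet_set_inj : injective facet_set.
Proof.
move=> i j ij; apply/val_inj/setP => k.
by apply/idP/idP => /facet_set_vertex h; apply/facet_set_vertex;
  [rewrite -ij|rewrite ij].
Qed.

Lemma facet_set_is_facet i : has_dim P n.+1 -> is_facet P (facet_set i).
Proof.
move=> Pdim; have [cP cT cs] := facet_normalP i; set c := facet_normal i in cP cT *.
have c0 : c != 0.
  apply/eqP => c0; have : delta_mx 0 0 = 0 :> V.
    by apply: cs => k; rewrite -cT inE c0 dotprod0l eq_sym oner_eq0.
  by move/rowP/(_ 0); rewrite !mxE !eqxx => /eqP; rewrite oner_eq0.
split.
  exists c, (1 + dotprod c centroid); split=> [x /facet_halfspaces/(_ i)|].
    by rewrite dotprodBr lerBlDr.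
  apply/seteqP; split=> x [Px /eqP cx]; split=> //; apply/eqP.
    by move: cx; rewrite dotprodBr subr_eq.
  by rewrite dotprodBr subr_eq.
exists n; split=> //.
have [U [dimU memU]] := dim_orthogonal c0.
(* The foot of the perpendicular from the centroid to the hyperplane of the facet. *)
pose x0 := centroid + (dotprod c c)^-1 *: c.
have cx0 : dotprod c (x0 - centroid) = 1.
  by rewrite addrC addKr dotprodZr mulVf // dotprod_eq0.
exists x0, U; split=> //; apply/seteqP; split=> x.
  case=> [k [p [t [pF t1 xE]]]]; exists (x - x0); last by rewrite addrCA subrr addr0.
  rewrite /= memU (_ : x - x0 = (x - centroid) - (x0 - centroid)); last first.
    by rewrite opprB addrA subrK.
  rewrite dotprodBr cx0 subr_eq0; apply/eqP.
  rewrite xE dotprodBr dotprod_sumr -[dotprod c centroid]mul1r -t1 mulr_suml.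
  rewrite -sumrB; apply: eq_bigr => j _.
  by rewrite dotprodZr -mulrBr -dotprodBr (pF j).2 mulr1.
case=> u /=; rewrite memU => /eqP cu <-.
have [t yE] := spanning_combination (x0 + u - centroid) cs.
(* Pairing with [c], which is [1] on every tight generator, shows that the linear combination is
   affine. *)
have t1 : \sum_(k in val i) t k = 1.
  have : dotprod c (x0 + u - centroid) = 1 by rewrite addrAC dotprodDr cu addr0.
  rewrite yE dotprod_sumr => <-; apply: eq_bigr => k.
  by rewrite dotprodZr -cT inE => /eqP ->; rewrite mulr1.
exists #|val i|, (fun j => a (enum_val j)), (fun j => t (enum_val j)); split.
- by move=> j; apply/facet_set_vertex/enum_valP.
- by rewrite -t1 [RHS]big_enum_val.
- rewrite -(big_enum_val (fun k => t k *: a k)).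
  apply/eqP; rewrite -(subrK centroid (x0 + u)) yE -[X in _ + X]scale1r -t1.
  rewrite scaler_suml -big_split /=; apply/eqP/eq_bigr => k _.
  by rewrite -scalerDr subrK.
Qed.

End Family.

Lemma polytope_facets (P : set V) : is_polytope P -> has_dim P n.+1 ->
  exists (q : V) (I : finType) (c : I -> V) (M : R),
    let F i := [set x | P x /\ dotprod (c i) (x - q) = 1] in
    [/\ P q, forall x, P x <-> forall i, dotprod (c i) (x - q) <= 1,
        forall x, P x -> `|x - q| <= M,
        injective F & forall i, is_facet P (F i)].
Proof.
move=> [A /finite_seqP[s ->] PE] Pdim.
pose a := tnth (in_tuple s).
have PE' : P = [set barycenter a t | t in convex_weights (N := size s)].
  rewrite -convex_hull_family PE; congr convex_hull; apply/seteqP; split=> x /=.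
    by move=> /(tnthP (in_tuple s))[k ->]; exists k.
  by move=> [k _ <-]; exact: (mem_tnth k (in_tuple s)).
have Pfull := affine_hull_full Pdim; rewrite PE' in Pdim Pfull *.
exists (centroid a), (facet_index a), (@facet_normal _ a).
exists (\sum_k `|a k| + `|centroid a|); split.
- exact: centroid_in_hull.
- exact: facet_halfspaces.
- move=> _ [t tw <-]; apply: le_trans (ler_normB _ _) _.
  by rewrite lerD2r barycenter_norm.
- exact: facet_set_inj.
- by move=> i; exact: facet_set_is_facet.
Qed.

End Polytope.

(** * Coverings *)

Lemma injective_card_ge (T : finType) (U : Type) (J : {set T}) (h : T -> U)
    (S : set U) (n : nat) :
  (n <= #|J|)%N -> injective h -> (forall j, j \in J -> S (h j)) -> `I_n #<= S.
Proof.
move=> nJ hinj hS; pose f (k : 'I_n) := h (enum_val (widen_ord nJ k)).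
have finj : injective f.
  by move=> k l /hinj/enum_val_inj/(congr1 val) kl; exact: val_inj.
rewrite (card_le_eql card_II) -(card_le_eql (inj_card_eq (in2W finj))).
by apply: subset_card_le => _ [k _ <-]; apply/hS/enum_valP.
Qed.

(** The distance to [A] works; for empty [A] it would be infinite, and the constant [1] replaces
    it. *)
Lemma closed_zero_set (R : realType) (V : normedModType R) (A : set V) :
  closed A -> exists d : V -> R,
    [/\ continuous d, forall x, 0 <= d x & forall x, d x = 0 <-> A x].
Proof.
move=> Acl; have [->|/set0P[a0 Aa0]] := eqVneq A set0.
  exists (fun=> 1); split=> // [x|x]; first exact: cst_continuous.
  by split=> // /eqP; rewrite oner_eq0.
have dfin x : edist_inf A x \is a fin_num.
  rewrite ge0_fin_numE ?edist_inf_ge0 //.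
  apply: (@le_lt_trans _ _ (edist (x, a0))).
    by apply: ereal_inf_lbound; exists a0.
  rewrite -ge0_fin_numE ?edist_ge0 //; apply/edist_finP.
  exists (`|x - a0| + 1) => /=; first by rewrite ltr_wpDl.
  by rewrite -ball_normE /= ltrDl.
exists (fun x => fine (edist_inf A x)); split=> [x|x|x].
- by apply: fine_cvg; rewrite fineK //; exact: edist_inf_continuous.
- by rewrite fine_ge0 ?edist_inf_ge0.
split=> [dx|Ax]; last by rewrite (edist_inf0 Ax).
apply: Acl => B /nbhs_ballP[e /= e0 eB].
have : (edist_inf A x < e%:E)%E by rewrite -(fineK (dfin x)) dx lte_fin.
case/ereal_inf_lt => _ [a Aa <-] /edist_lt_ball /= xa.
by exists a; split=> //; exact: eB.
Qed.

Lemma positive_lower_bound (R : realType) (T : topologicalType) (K : finType)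
    (A : K -> set T) (f : K -> T -> R) :
  (forall k, compact (A k)) -> (forall k, continuous (f k)) ->
  (forall k x, A k x -> 0 < f k x) ->
  exists2 e : R, 0 < e & forall k x, A k x -> e <= f k x.
Proof.
move=> Ac fc f0.
have /choice[e eP] : forall k, exists e : R, 0 < e /\ forall x, A k x -> e <= f k x.
  move=> k; have [A0|/set0P A0] := eqVneq (A k) set0.
    by exists 1; split=> // x; rewrite A0.
  have [c /set_mem Akc cmin] := compact_EVT_min A0 (Ac k) (continuous_subspaceT (fc k)).
  by exists (f k c); split=> [|x Akx]; [exact: f0|exact/cmin/mem_set].
exists (\big[Num.min/1]_k e k).
  by elim/big_ind: _ => // [x y x0 y0|k _]; [rewrite lt_min x0|have [] := eP k].
move=> k x /((eP k).2); apply: le_trans; exact: bigmin_le.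
Qed.

Section Covering.
Variables (R : realType) (m : nat) (I : finType).
Local Notation n := m.+1.
Local Notation V := 'rV[R]_n.
Variables (c : I -> V) (M : R) (N : nat) (X : 'I_N -> set V).

Let Q : set V := [set x | forall j, dotprod (c j) x <= 1].
Let F j : set V := [set x | Q x /\ dotprod (c j) x = 1].

Hypothesis Q_bounded : forall x, Q x -> `|x| <= M.
Hypothesis X_closed : forall i, closed (X i).
Hypothesis X_cover : Q `<=` \bigcup_i X i.
Hypothesis X_multiplicity : forall (K : {set 'I_N}) x,
  (forall i, i \in K -> X i x) -> (#|K| <= n)%N.

Lemma polyhedron_compact : compact Q.
Proof.
apply: bounded_closed_compact.
  exists M; split=> [|M' MM' x /= /Q_bounded /le_trans]; first exact: num_real.
  by apply; exact: ltW.
have -> : Q = \bigcap_j [set x | dotprod (c j) x <= 1].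
  by apply/seteqP; split=> x Qx j //=; exact: Qx.
apply: closed_bigI => j _; apply: (@closed_comp _ _ (dotprod (c j)) [set y | y <= 1]).
  by move=> x _; exact: dotprod_continuous.
exact: closed_le.
Qed.

Lemma facet_compact j : compact (F j).
Proof.
apply: compact_closedI; first exact: polyhedron_compact.
apply: (@closed_comp _ _ (dotprod (c j)) [set y | y = 1]).
  by move=> x _; exact: dotprod_continuous.
exact: closed_eq.
Qed.

Definition touched i : {set I} := [set j | `[< X i `&` F j !=set0 >]]%SET.

(** Each [f i] is positive exactly where [d i < e], with [d i] vanishing on [X i]. For small [e]
    these neighbourhoods keep the multiplicity bound and meet no new facet. *)
Lemma bump_functions : exists (f : 'I_N -> V -> R), exists2 e : R, 0 < e &
  [/\ forall i, continuous (f i), forall i x, 0 <= f i x,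
      forall x, Q x -> e <= \sum_i f i x,
      forall x, Q x -> (#|[set i | (0 < f i x)%R]%SET| <= n)%N &
      forall i j x, F j x -> 0 < f i x -> j \in touched i].
Proof.
have /choice[d dP] := fun i => closed_zero_set (@X_closed i).
have dc i : continuous (d i) by have [] := dP i.
have d0 i x : 0 <= d i x by have [_ ->] := dP i.
have dX i x : d i x = 0 <-> X i x by have [_ _ ->] := dP i.
(* More than [n] of the sets have no common point, so the largest of their [d i] is bounded below on
   the compact [Q]. *)
have [e1 e10 e1P] : exists2 e : R, 0 < e & forall (K : {set 'I_N}) x,
    Q x /\ (n < #|K|)%N -> e <= \big[Num.max/0]_(i in K) d i x.
  apply: (@positive_lower_bound R V _ (fun K : {set 'I_N} => [set x | Q x /\ (n < #|K|)%N])
    (fun K x => \big[Num.max/0]_(i in K) d i x)) => [K|K|K x [_ Kn]].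
  - have [Kn|Kn] := ltnP n #|K|.
      rewrite (_ : mkset _ = Q); first exact: polyhedron_compact.
      by apply/seteqP; split=> [x []|x Qx].
    rewrite (_ : mkset _ = set0); first exact: compact0.
    by apply/seteqP; split=> // x [_].
  - apply: continuous_big => [|i _]; first exact: max_continuous.
    exact: dc.
  - rewrite lt_def bigmax_ge_id andbT; apply: contraTneq Kn => K0.
    rewrite -leqNgt; apply: (@X_multiplicity K x) => i iK; apply/dX/eqP.
    by rewrite eq_le d0 -K0 le_bigmax_cond.
(* Similarly, [d i] is bounded below on each facet that [X i] misses. *)
have [e2 e20 e2P] : exists2 e : R, 0 < e & forall (ij : 'I_N * I) x,
    F ij.2 x /\ ij.2 \notin touched ij.1 -> e <= d ij.1 x.
  apply: (@positive_lower_bound R V _ (fun ij : 'I_N * I => [set x | F ij.2 x /\ ij.2 \notin touched ij.1])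
    (fun ij => d ij.1)) => [[i j]|[i j]|[i j] x] /=.
  - have [jT|jT] := boolP (j \in touched i).
      rewrite (_ : mkset _ = set0); first exact: compact0.
      by apply/seteqP; split=> // x [].
    rewrite (_ : mkset _ = F j); first exact: facet_compact.
    by apply/seteqP; split=> [x []|x Fx].
  - exact: dc.
  - move=> [Fx jT]; rewrite lt_def d0 andbT; apply: contraNneq jT => /dX Xx.
    by rewrite inE; apply/asboolP; exists x.
pose e := Num.min e1 e2.
have e0 : 0 < e by rewrite lt_min e10.
exists (fun i x => Num.max 0 (e - d i x)), e => //.
have pos i x : (0 < Num.max 0 (e - d i x)) = (d i x < e).
  by rewrite lt_max ltxx subr_gt0.
split=> [i x|i x|x Qx|x Qx|i j x Fx].
- apply: (@continuous_max _ _ (fun=> 0) (fun x => e - d i x)).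
    exact: cst_continuous.
  exact: (continuousB (@cst_continuous _ _ _ x) (@dc i x)).
- by rewrite le_max lexx.
- have [i _ /dX Xx] := X_cover Qx.
  rewrite (bigD1 i) //= Xx subr0 max_r ?(ltW e0) // lerDl sumr_ge0 // => k _.
  by rewrite le_max lexx.
- rewrite leqNgt; apply/negP => Kn.
  have /bigmax_geP[|[i]] := e1P _ _ (conj Qx Kn); first by rewrite leNgt e10.
  by rewrite inE pos leNgt => /lt_le_trans ->//; rewrite ge_min lexx.
- rewrite pos; apply: contraTT => jT; rewrite -leNgt.
  by apply: le_trans (e2P (i, j) x (conj Fx jT)); rewrite ge_min lexx orbT.
Qed.

Definition l1norm (u : V) : R := \sum_k `|u 0 k|.

Lemma covering_touches : exists i, (n < #|touched i|)%N.
Proof.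
apply: contrapT => /forallNP ntouch.
have touch_le i : (#|touched i| <= n)%N by rewrite leqNgt; apply/negP/ntouch.
have Q0 : Q 0 by move=> j; rewrite dotprod0r.
have M0 : 0 <= M by apply: le_trans (Q_bounded Q0).
have l1_ge0 u : 0 <= l1norm u by exact: sumr_ge0.
have l1_le (u : I -> V) j : l1norm (u j) <= \sum_j l1norm (u j).
  by rewrite (bigD1 j) //= lerDl sumr_ge0 // => k _; exact: l1_ge0.
have dot_le (u : I -> V) j x : `|dotprod (u j) x| <= (\sum_j l1norm (u j)) * `|x|.
  apply: le_trans (ler_dotprod_norm _ _) _.
  by rewrite ler_wpM2r // l1_le.
pose W := \sum_(j : I) l1norm (moment_vector R n j).
have W0 : 0 <= W by apply: sumr_ge0 => j _; exact: l1_ge0.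
(* On [Q] the perturbation changes [c j] by at most [e * (W * M) < 1], so [c' j] stays positive on
   facet [j]. *)
have [|e /andP[e0 eW] ePos] :=
    @general_position_perturbation R n I c (1 + W * M)^-1.
  by rewrite invr_gt0 ltr_pwDl // mulr_ge0.
have /choice[p pP] := fun i => ePos _ (touch_le i).
pose c' j := c j + e *: moment_vector R n j.
pose B := \sum_j l1norm (c' j).
have B0 : 0 <= B by apply: sumr_ge0 => j _; exact: l1_ge0.
have B1 : 0 < 1 + B by rewrite ltr_pwDl.
(* The point [g] avoids the affine span of any [n] or fewer of the [p i], and is small enough that
   every [c' j] is below [1] at it. *)
have [|g gB gP] := @generic_point R n _ p (1 + B)^-1; first by rewrite invr_gt0.
have c'g j : dotprod (c' j) g < 1.
  apply: le_lt_trans (ler_norm _) _; apply: le_lt_trans (dot_le c' j g) _.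
  apply: le_lt_trans (ler_wpM2l B0 gB) _.
  by rewrite ltr_pdivrMr // mul1r ltrDr.
have c'x j x : Q x -> dotprod (c j) x = 1 -> 0 < dotprod (c' j) x.
  move=> Qx cx; rewrite dotprodDl dotprodZl cx.
  have : e * `|dotprod (moment_vector R n j) x| < 1.
    apply: (@le_lt_trans _ _ (e * (W * M))).
      rewrite ler_pM2l //; apply: le_trans (dot_le _ j x) _.
      by rewrite ler_wpM2l // Q_bounded.
    have D0 : 0 < 1 + W * M by rewrite ltr_pwDl // mulr_ge0.
    apply: (@lt_trans _ _ (e * (1 + W * M))); first by rewrite ltr_pM2l // ltrDr.
    by rewrite -ltr_pdivlMr // mul1r.
  have := ler_norm (- dotprod (moment_vector R n j) x); rewrite normrN.
  by rewrite -(ler_pM2l e0) mulrN; lra.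
have [f [d d0 [fc f0 fQ fn fF]]] := bump_functions.
pose S x := \sum_i f i x.
(* The maximum with [d] keeps the denominator positive off [Q]. On [Q] it equals [S x], and
   [h x + g] is a convex combination of the [p i]. *)
pose h x : V := (Num.max d (S x))^-1 *: (\sum_i f i x *: p i) - g.
have Sd x : 0 < Num.max d (S x) by rewrite lt_max d0.
have hc : continuous h.
  have Sc : continuous (fun x => (Num.max d (S x))^-1).
    have Dc : continuous (fun x => Num.max d (S x)).
      move=> x; apply: (@continuous_max _ _ (fun=> d) S).
        exact: cst_continuous.
      apply: continuous_big => [|i _]; first exact: add_continuous.
      exact: fc.
    by move=> x; exact: (@continuousV _ _ (fun x => Num.max d (S x)) x (lt0r_neq0 (Sd x)) (@Dc x)).
  have pc : continuous (fun x => \sum_i f i x *: p i).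
    apply: continuous_big => [|i _]; first exact: add_continuous.
    by move=> x; exact: (continuousZ (@fc i x) (@cst_continuous _ _ _ x)).
  move=> x.
  exact: (continuousB (continuousZ (@Sc x) (@pc x)) (@cst_continuous _ _ _ x)).
have [|x Qx hx] := @zero_in_polyhedron R m I c c' h M Q_bounded hc.
  (* On facet [j] only those [p i] with [c' j] equal to [1] have positive weight, so [c' j] takes
     the value [1 - dotprod (c' j) g > 0] at [h x]. *)
  move=> j x Qx cx; split; first exact: c'x.
  rewrite dotprodBr dotprodZr dotprod_sumr subr_gt0.
  rewrite (eq_bigr (fun i => f i x)) => [|i _]; last first.
    rewrite dotprodZr; have := f0 i x; rewrite le_eqVlt => /orP[/eqP <-|fi].
      by rewrite mul0r.
    by rewrite pP ?mulr1 //; apply: fF fi.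
  by rewrite max_r ?fQ // mulVf ?c'g // gt_eqF // (lt_le_trans d0) // fQ.
(* A zero of [h] makes [g] an affine combination of at most [n] of the [p i], against its choice. *)
move/eqP: hx; rewrite subr_eq0 max_r ?fQ // => /eqP/esym.
have S0 : 0 < S x by exact: lt_le_trans d0 (fQ x Qx).
have fsupp i : i \notin [set i | (0 < f i x)%R]%SET -> f i x = 0.
  by rewrite inE -leNgt => fi; apply/eqP; rewrite eq_le fi f0.
rewrite scaler_sumr (bigID (mem [set i | (0 < f i x)%R]%SET)) /=.
rewrite [X in _ + X]big1 => [|i /fsupp ->]; last by rewrite scale0r scaler0.
rewrite addr0 (eq_bigr (fun i => ((S x)^-1 * f i x) *: p i)) => [|i _]; last first.
  by rewrite scalerA.
apply: gP; first exact: fn.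
rewrite -mulr_sumr (_ : \sum_(i in _) f i x = S x) ?mulVf ?gt_eqF //.
rewrite /S [RHS](bigID (mem [set i | (0 < f i x)%R]%SET)) /=.
by rewrite [X in _ + X]big1 ?addr0 // => i /fsupp.
Qed.

End Covering.

Theorem theorem5p2 (R : realType) (n : nat) (P : set 'rV[R]_n)
    (N : nat) (X : 'I_N -> set 'rV[R]_n) :
  (1 <= n)%N ->
  is_simple_polytope n P ->
  (forall i, closed (X i)) ->
  (forall i, X i `<=` P) ->
  P `<=` \bigcup_i X i ->
  multiplicity_at_most X n ->
  exists i, `I_n.+1 #<= [set F | is_facet P F /\ X i `&` F !=set0].
Proof.
case: n P X => // m P X _ [Ppoly Pdim _] Xcl _ Xcov Xmult.
have [q [I [c [M [Pq PE PM Finj Ffacet]]]]] := polytope_facets Ppoly Pdim.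
have qK y : q + y - q = y by rewrite addrAC subrr add0r.
(* Translation moves the interior point [q] of [P] to the origin. *)
pose Y i : set 'rV[R]_m.+1 := [set y | X i (q + y)].
have PE' y : P (q + y) <-> forall j, dotprod (c j) y <= 1.
  by have := PE (q + y); rewrite qK.
have [|i||K x Kx|i ti] := @covering_touches R m I c M N Y.
- by move=> y /PE'/PM; rewrite qK.
- apply: (@closed_comp _ _ (fun y => q + y)) => // y _.
  exact: (continuousD (@cst_continuous _ _ _ y) (@cvg_id _ _)).
- by move=> y /PE'/Xcov[i _ Xi]; exists i.
- rewrite -card_le_II; apply: card_le_trans (Xmult (q + x)).
  by apply: (injective_card_ge (J := K) (h := id)).
exists i; apply: (injective_card_ge ti Finj) => j.
rewrite inE => /asboolP[y [Yy [Qy cy]]]; split; first exact: Ffacet.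
exists (q + y); split=> //; split; first exact/PE'.
by rewrite qK.
Qed.
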